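(* Let $n\in\mathbb{N}$, $n\ge 1$, and suppose $n+1$ is an Hadamard number. If $S$ is an $n$-dimensional regular simplex whose vertices coincide with vertices of $Q_n$, then for the corresponding interpolation projector $P:C(Q_n)\to\Pi_1(\mathbb{R}^n)$ $$\|P\|_{Q_n}\leq \sqrt{2n+3}+1.$$
   Context: An Hadamard matrix of order $m$ is an $m\times m$ matrix $\mathbf{H}$ with entries $\pm 1$ satisfying $\mathbf{H}^{-1}=\frac1m\mathbf{H}^T$; $m$ is called an Hadamard number if there exists an Hadamard matrix of order $m$. $Q_n:=[0,1]^n$. $C(Q_n)$ is the space of continuous functions $f:Q_n\to\mathbb{R}$ with the norm $\|f\|_{C(Q_n)}:=\max_{x\in Q_n}|f(x)|$. $\Pi_1(\mathbb{R}^n)$ is the set of real polynomials in $n$ variables of degree $\leq 1$. For a nondegenerate simplex $S\subset Q_n$ with vertices $x^{(1)},\ldots,x^{(n+1)}$, the interpolation projector $P:C(Q_n)\to\Pi_1(\mathbb{R}^n)$ corresponding to $S$ is defined by $Pf(x^{(j)})=f(x^{(j)})$, $j=1,\ldots,n+1$. $\|P\|_{Q_n}$ denotes the norm of $P$ as an operator from $C(Q_n)$ to $C(Q_n)$. *)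

(* Defs.v *)
From HB Require Import structures.
From mathcomp Require Import all_boot all_order all_algebra.
(* Notations left out: they clash with those of MathComp-Analysis. *)
From mathcomp Require Import -(notations) mpoly.
From mathcomp Require Import all_classical all_reals all_analysis.

Set Implicit Arguments.
Unset Strict Implicit.
Unset Printing Implicit Defensive.

Import Order.TTheory GRing.Theory Num.Theory.
Import numFieldNormedType.Exports.

Local Open Scope classical_set_scope.
Local Open Scope ring_scope.

(* unitmx is required because invmx H is H when H is not invertible. *)
Definition is_hadamard (R : realType) (m : nat) (H : 'M[R]_m) : Prop :=
  [/\ forall i j, H i j = 1 \/ H i j = -1,
      H \in unitmx
    & invmx H = m%:R^-1 *: H^T].

Definition hadamard_number (R : realType) (m : nat) : Prop :=
  exists H : 'M[R]_m, is_hadamard H.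

Definition cube (R : realType) (n : nat) : set 'rV[R]_n :=
  [set x | forall i, 0 <= x ord0 i <= 1].
Arguments cube : clear implicits.

Definition cube_vertices (R : realType) (n : nat) : set 'rV[R]_n :=
  [set x | forall i, x ord0 i = 0 \/ x ord0 i = 1].

(* C(Q_n), each element being represented by any of its extensions to R^n: only
   the values on the cube matter. *)
Definition continuous_on_cube (R : realType) (n : nat) : set ('rV[R]_n -> R) :=
  [set f | {within cube R n, continuous f}].

(* The maximum norm, written as a supremum in the extended reals so that no
   default value is involved; on C(Q_n) it is finite and attained. *)
Definition cube_norm (R : realType) (n : nat) (f : 'rV[R]_n -> R) : \bar R :=
  ereal_sup [set (`|f x|)%:E | x in cube R n].

(* The norm of an operator from C(Q_n) to C(Q_n), again extended-real valued:
   an unbounded operator has norm +oo. *)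
Definition operator_norm (R : realType) (n : nat)
    (P : ('rV[R]_n -> R) -> ('rV[R]_n -> R)) : \bar R :=
  ereal_sup [set cube_norm (P f) | f in
    [set f | continuous_on_cube f /\ (cube_norm f <= 1%:E)%E]].

(* The polynomial functions of degree at most 1 (msize is 1 + the degree). *)
Definition Pi1 (R : realType) (n : nat) : set ('rV[R]_n -> R) :=
  [set g | exists p : mpoly.mpoly n R, (mpoly.msize p <= 2)%N /\
           forall x : 'rV[R]_n, g x = mpoly.meval (fun i => x ord0 i) p].

Definition euclidean_dist (R : realType) (n : nat) (x y : 'rV[R]_n) : R :=
  Num.sqrt (\sum_(i < n) (x ord0 i - y ord0 i) ^+ 2).

(* A simplex is given by the family of its n + 1 vertices; nondegenerate means
   that they are affinely independent. *)
Definition nondegenerate_simplex (R : realType) (n : nat)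
    (v : 'I_n.+1 -> 'rV[R]_n) : Prop :=
  forall c : 'I_n.+1 -> R,
    \sum_j c j = 0 -> \sum_j c j *: v j = 0 -> forall j, c j = 0.

Definition regular_simplex (R : realType) (n : nat)
    (v : 'I_n.+1 -> 'rV[R]_n) : Prop :=
  nondegenerate_simplex v /\
  exists d : R, forall i j, i != j -> euclidean_dist (v i) (v j) = d.

(* P is the projector C(Q_n) -> Pi_1(R^n) interpolating at the vertices v. *)
Definition interpolation_projector (R : realType) (n : nat)
    (v : 'I_n.+1 -> 'rV[R]_n) (P : ('rV[R]_n -> R) -> ('rV[R]_n -> R)) : Prop :=
  forall f, continuous_on_cube f ->
    Pi1 (P f) /\ forall j, P f (v j) = f (v j).

(* Main.v *)
Require Import Defs.
From HB Require Import structures.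
From mathcomp Require Import all_boot all_order all_algebra.
From mathcomp Require Import -(notations) mpoly.
From mathcomp Require Import all_classical all_reals all_analysis.
From mathcomp Require Import ring lra.
Import Order.TTheory GRing.Theory Num.Theory.
Import numFieldNormedType.Exports.
Local Open Scope classical_set_scope.
Local Open Scope ring_scope.

(** A stronger bound holds: the norm is at most [Num.sqrt n.+1%:R].

    Send a point x of the cube to the row (1, 2x - 1) of length n + 1.  Under
    this map affine relations between points are linear relations between rows,
    a vertex of the cube becomes a row of signs, and a point of the cube becomes
    a row of squared length at most n + 1.  Let A be the square matrix of the
    rows of the vertices of the simplex.  It is invertible since the simplex is
    nondegenerate, and since the simplex is regular its rows have pairwise the
    same inner product.  An invertible matrix with equiangular rows of squared
    length n + 1 and a column of ones has orthogonal rows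
    ([equiangular_unit_ones_col_orthogonal]): A is a Hadamard matrix, which
    fixes the edge length of the simplex.

    The barycentric coordinates l of a point x of the cube satisfy
    l A = (1, 2x - 1).  As A is sqrt (n + 1) times an orthogonal matrix, their
    squares sum to |(1, 2x - 1)|^2 / (n + 1) <= 1
    ([barycentric_sqr_le1]), so by Cauchy-Schwarz their absolute values sum to at
    most sqrt (n + 1).  An affine function takes at x the combination, with
    coefficients l, of its values at the vertices; for the interpolant of an f
    with sup norm at most 1, these values are at most 1 in absolute value, so
    |P f x| is at most sqrt (n + 1). *)

(** The all-ones vector u is the image under A of the k-th unit vector e, and it
    is an eigenvector of the Gram matrix with eigenvalue s = m + (m - 1) c.
    Cancelling A in A (A^T u) = s A e gives A^T u = s e; the k-th entry of A^T u
    is the sum m of the k-th column, so m = s and c = 0. *)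
Lemma equiangular_unit_ones_col_orthogonal (F : numFieldType) (m : nat)
    (A : 'M[F]_m) (k : 'I_m) (c : F) :
    (1 < m)%N -> A \in unitmx -> (forall i, A i k = 1) ->
    (forall i j, (A *m A^T) i j = if i == j then m%:R else c) ->
  A *m A^T = m%:R%:M.
Proof.
move=> m_gt1 Au Ak gramA.
pose u : 'cV[F]_m := const_mx 1.
have uE : A *m delta_mx k 0 = u.
  by rewrite -colE; apply/matrixP => i j; rewrite !mxE Ak.
have eigu : A *m (A^T *m u) = (m%:R + (m%:R - 1) * c) *: u.
  apply/matrixP => i j; rewrite mulmxA mxE.
  under eq_bigr => l _ do rewrite gramA [u _ _]mxE mulr1.
  rewrite (bigD1 i) //= eqxx !mxE mulr1; congr (_ + _).
  under eq_bigr => l nli do rewrite eq_sym (negbTE nli).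
  rewrite sumr_const cardC1 card_ord -[LHS]mulr_natl.
  by rewrite -[in RHS](prednK (ltnW m_gt1)) -natr1 addrK.
have colsum : A^T *m u = (m%:R + (m%:R - 1) * c) *: delta_mx k 0.
  by apply: (can_inj (mulKmx Au)); rewrite eigu -scalemxAr uE.
have c0 : c = 0.
  have := congr1 (fun M : 'cV_m => M k 0) colsum; rewrite !mxE !eqxx mulr1.
  under eq_bigr => l _ do rewrite !mxE Ak mulr1.
  rewrite sumr_const card_ord => /eqP.
  rewrite -subr_eq0 opprD addrA subrr sub0r oppr_eq0 mulf_eq0 subr_eq0.
  by rewrite pnatr_eq1 gtn_eqF //= => /eqP.
by apply/matrixP => i j; rewrite gramA mxE c0; case: eqP.
Qed.

(** Degree at most 1 leaves only the monomials 1 and x_i: the first commutes with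
    combinations of total weight 1, the second with all linear combinations. *)
Lemma Pi1_affine_comb (R : realType) (n : nat) (I : finType)
    (g : 'rV[R]_n -> R) (l : I -> R) (y : I -> 'rV[R]_n) :
    Pi1 g -> \sum_j l j = 1 ->
  g (\sum_j l j *: y j) = \sum_j l j * g (y j).
Proof.
move=> [p [p2 gE]] l1; rewrite gE mevalE.
under [RHS]eq_bigr => j _ do rewrite gE mevalE mulr_sumr.
rewrite [RHS]exchange_big /=; apply: eq_big_seq => mm mmp.
under [RHS]eq_bigr => j _ do rewrite mulrCA.
rewrite -mulr_sumr; congr (_ * _).
have : (mdeg mm < 2)%N by apply: leq_trans (msize_mdeg_lt mmp) p2.
rewrite ltnS leq_eqVlt ltnS leqn0 => /orP[/mdeg1P[i /eqP ->]|].
  have monoE (x : 'rV[R]_n) :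
      \prod_(i0 < n) x ord0 i0 ^+ fun_of_multinom (mnm1 i) i0
      = x ord0 i.
    rewrite (bigD1 i) //= mnm1E eqxx expr1 big1 ?mulr1 // => i' ni.
    by rewrite mnm1E eq_sym (negbTE ni) expr0.
  rewrite monoE; under [RHS]eq_bigr => j _ do rewrite monoE.
  by rewrite summxE; apply: eq_bigr => j _; rewrite mxE.
rewrite mdeg_eq0 => /eqP ->.
have monoE (x : 'rV[R]_n) :
    \prod_(i0 < n) x ord0 i0 ^+ fun_of_multinom mnm0 i0 = 1.
  by rewrite big1 // => i _; rewrite mnm0E expr0.
by rewrite monoE; under [RHS]eq_bigr => j _ do rewrite monoE mulr1.
Qed.

(** Cauchy-Schwarz against the all-ones vector, in the form of the termwise
    inequality 2 s |t| <= s^2 t^2 + 1 with s^2 = m. *)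
Lemma norm1_le_sqrt (R : realType) (m : nat) (l : 'I_m -> R) :
  \sum_j l j ^+ 2 <= 1 -> \sum_j `|l j| <= Num.sqrt m%:R.
Proof.
case: m l => [|m] l l2; first by rewrite big_ord0 sqrtr_ge0.
set s := Num.sqrt _.
have s_gt0 : 0 < s by rewrite sqrtr_gt0 ltr0n.
have s2 : s ^+ 2 = m.+1%:R by rewrite sqr_sqrtr ?ler0n.
have amgm j : 2 * s * `|l j| <= s ^+ 2 * l j ^+ 2 + 1.
  rewrite -(real_normK (num_real (l j))).
  by have := sqr_ge0 (s * `|l j| - 1); lra.
have : \sum_j (2 * s * `|l j|) <= \sum_j (s ^+ 2 * l j ^+ 2 + 1).
  by apply: ler_sum => j _; apply: amgm.
rewrite big_split /= -!mulr_sumr sumr_const card_ord -s2 => h.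
by nra.
Qed.

Section SignCoordinates.
Variables (R : realType) (n : nat).
Implicit Types (x y : 'rV[R]_n) (v : 'I_n.+1 -> 'rV[R]_n).

(** Homogeneous coordinates of 2x - 1: the map x |-> 2x - 1 turns the vertices of
    the unit cube into sign vectors, and the leading 1 linearizes affine
    combinations. *)
Definition sign_row x : 'rV[R]_(1 + n) :=
  row_mx (const_mx 1) (2 *: x - const_mx 1).

Definition sign_mx v : 'M[R]_(1 + n) := \matrix_j sign_row (v j).

Lemma sign_row0 x : sign_row x 0 (lshift n 0) = 1.
Proof. by rewrite row_mxEl mxE. Qed.

Lemma sign_rowS x i : sign_row x 0 (rshift 1 i) = 2 * x 0 i - 1.
Proof. by rewrite row_mxEr !mxE. Qed.

Lemma sign_row_inj : injective sign_row.
Proof.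
move=> x y xy; apply/rowP => i.
have := congr1 (fun r : 'rV_(1 + n) => r 0 (rshift 1 i)) xy.
by rewrite !sign_rowS; lra.
Qed.

Lemma sign_row_affine_comb (I : finType) (l : I -> R) (y : I -> 'rV[R]_n) :
  \sum_j l j = 1 -> sign_row (\sum_j l j *: y j) = \sum_j l j *: sign_row (y j).
Proof.
move=> l1; apply/rowP => i; rewrite summxE.
under [RHS]eq_bigr => j _ do rewrite mxE.
case: (split_ordP i) => k ->.
  by rewrite ord1 sign_row0; under eq_bigr => j _ do rewrite sign_row0 mulr1.
rewrite sign_rowS summxE; under [RHS]eq_bigr => j _ do
  rewrite sign_rowS mulrBr mulr1.
rewrite sumrB l1 mulr_sumr; congr (_ - _).
by apply: eq_bigr => j _; rewrite mxE mulrCA.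
Qed.

Lemma sign_row_sqr_cube x : cube R n x ->
  \sum_i sign_row x 0 i ^+ 2 <= n.+1%:R.
Proof.
move=> xQ; rewrite -[X in _ <= X%:R]card_ord -sumr_const.
apply: ler_sum => i _; case: (split_ordP i) => k ->.
  by rewrite ord1 sign_row0 expr1n.
by rewrite sign_rowS; have := xQ k; rewrite /= => /andP[]; nra.
Qed.

Lemma sign_row_sqr_vertex x : cube_vertices x ->
  \sum_i sign_row x 0 i ^+ 2 = n.+1%:R.
Proof.
move=> xV; rewrite -[RHS]/(1 *+ n.+1) -[X in _ = _ *+ X]card_ord -sumr_const.
apply: eq_bigr => i _; case: (split_ordP i) => k ->.
  by rewrite ord1 sign_row0 expr1n.
by rewrite sign_rowS; have [->|->] := xV k; ring.
Qed.

Lemma sign_row_dist x y :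
  \sum_i (sign_row x 0 i - sign_row y 0 i) ^+ 2 = 4 * euclidean_dist x y ^+ 2.
Proof.
rewrite sqr_sqrtr; last by apply: sumr_ge0 => i _; apply: sqr_ge0.
rewrite big_split_ord /= big_ord1 !sign_row0 subrr expr0n add0r mulr_sumr.
by apply: eq_bigr => i _; rewrite !sign_rowS; ring.
Qed.

(** A linear relation between the rows (1, 2 v_j - 1) has total weight 0 by its
    first column, and is then an affine relation between the v_j. *)
Lemma sign_mx_unit v : nondegenerate_simplex v -> sign_mx v \in unitmx.
Proof.
move=> ndv; rewrite -row_free_unit; apply: inj_row_free => c cA0.
have colE i : \sum_j c 0 j * sign_row (v j) 0 i = 0.
  have := congr1 (fun r : 'rV_(1 + n) => r 0 i) cA0; rewrite !mxE => cA0i; rewrite -[RHS]cA0i.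
  by apply: eq_bigr => j _; rewrite [sign_mx v j i]mxE.
have c_sum0 : \sum_(j < n.+1) c 0 j = 0.
  rewrite -[RHS](colE (lshift n 0)).
  by apply: eq_bigr => j _; rewrite sign_row0 mulr1.
apply/rowP => j; rewrite [RHS]mxE; apply: (ndv (c 0)) => //.
apply/rowP => i; rewrite summxE mxE.
have := colE (rshift 1 i).
under eq_bigr => l _ do rewrite sign_rowS mulrBr mulr1 mulrCA.
rewrite sumrB c_sum0 subr0 -mulr_sumr => /eqP.
rewrite mulf_eq0 pnatr_eq0 /= => /eqP cv0; rewrite -[RHS]cv0.
by apply: eq_bigr => l _; rewrite mxE.
Qed.

(** Rows of signs have squared length n + 1, and distances are doubled by
    x |-> 2x - 1, so an edge of length d yields the inner product
    n + 1 - 2 d^2, the same for all edges. *)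
Lemma sign_mx_gram v : (1 <= n)%N -> regular_simplex v ->
  (forall j, cube_vertices (v j)) -> sign_mx v *m (sign_mx v)^T = n.+1%:R%:M.
Proof.
move=> n_gt0 [ndv [d distv]] vV.
apply: (equiangular_unit_ones_col_orthogonal _ _ _ (lshift n 0)
  (n.+1%:R - 2 * d ^+ 2)) => //.
- exact: sign_mx_unit.
- by move=> i; rewrite mxE sign_row0.
move=> i j; rewrite mxE; under eq_bigr => k _ do
  rewrite [_^T _ _]mxE ![sign_mx _ _ _]mxE.
case: eqVneq => [->|nij].
  rewrite -[RHS](sign_row_sqr_vertex _ (vV j)).
  by apply: eq_bigr => k _; rewrite expr2.
have polarization : \sum_k (sign_row (v i) 0 k - sign_row (v j) 0 k) ^+ 2 =
    n.+1%:R - 2 * (\sum_k sign_row (v i) 0 k * sign_row (v j) 0 k) + n.+1%:R.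
  under eq_bigr => k _ do rewrite sqrrB -mulr_natl.
  by rewrite big_split sumrB /= !sign_row_sqr_vertex // -mulr_sumr.
have := sign_row_dist (v i) (v j); rewrite distv // polarization.
by set a := \sum_ _ _; lra.
Qed.

End SignCoordinates.

Arguments sign_row {R n} x.
Arguments sign_mx {R n} v.

(** The coordinates l solve l A = (1, 2x - 1) with A A^T = n + 1, hence
    (n + 1) |l|^2 = |l A|^2 = |(1, 2x - 1)|^2 <= n + 1. *)
Lemma barycentric_sqr_le1 (R : realType) (n : nat) (v : 'I_n.+1 -> 'rV[R]_n)
    (x : 'rV[R]_n) :
    (1 <= n)%N -> regular_simplex v -> (forall j, cube_vertices (v j)) ->
    cube R n x ->
  exists l : 'I_n.+1 -> R,
    [/\ \sum_j l j = 1, x = \sum_j l j *: v j & \sum_j l j ^+ 2 <= 1].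
Proof.
move=> n_gt0 hS hv xQ.
set A := sign_mx v; have AAT : A *m A^T = n.+1%:R%:M by exact: sign_mx_gram.
have m_neq0 : n.+1%:R != 0 :> R by rewrite pnatr_eq0.
have [l lA] : exists l : 'rV[R]_(1 + n), l *m A = sign_row x.
  by exists (sign_row x *m invmx A); rewrite mulmxKV // sign_mx_unit //; case: hS.
have rowlA : \sum_j l 0 j *: sign_row (v j) = sign_row x.
  rewrite -lA mulmx_sum_row; apply: eq_bigr => j _.
  by rewrite rowK.
have l1 : \sum_(j < n.+1) l 0 j = 1.
  rewrite -(sign_row0 _ _ x) -rowlA summxE; apply: eq_bigr => j _.
  by rewrite [RHS]mxE sign_row0 mulr1.
have xE : x = \sum_j l 0 j *: v j.
  by apply: (@sign_row_inj R n); rewrite sign_row_affine_comb.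
exists (l 0); split => //.
have -> : \sum_j l 0 j ^+ 2 = n.+1%:R^-1 * \sum_i sign_row x 0 i ^+ 2.
  have sqE (y : 'rV[R]_(1 + n)) : \sum_j y 0 j ^+ 2 = (y *m y^T) 0 0.
    by rewrite mxE; apply: eq_bigr => j _; rewrite mxE expr2.
  rewrite !sqE -lA trmx_mul mulmxA -[_ *m A *m A^T]mulmxA AAT.
  by rewrite mul_mx_scalar -scalemxAl [in RHS]mxE mulKf.
by rewrite ler_pdivrMl ?ltr0n // mulr1 sign_row_sqr_cube.
Qed.

(** The sum of the |l j| bounds the norm because P f x is the combination, with
    coefficients l, of the values of f at the vertices. *)
Lemma operator_norm_regular_cube_simplex (R : realType) (n : nat)
    (v : 'I_n.+1 -> 'rV[R]_n) (P : ('rV[R]_n -> R) -> ('rV[R]_n -> R)) :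
    (1 <= n)%N -> regular_simplex v -> (forall j, cube_vertices (v j)) ->
    interpolation_projector v P ->
  (operator_norm P <= (Num.sqrt n.+1%:R)%:E)%E.
Proof.
move=> n_gt0 hS hv hP.
apply/ereal_supP => _ [f [fC f1] <-]; apply/ereal_supP => _ [x xQ <-].
have [PfPi Pfv] := hP f fC.
have [l [l1 xE l2]] := barycentric_sqr_le1 _ _ _ _ n_gt0 hS hv xQ.
rewrite lee_fin {1}xE Pi1_affine_comb //.
apply: le_trans (ler_norm_sum _ _ _) _.
apply: le_trans (norm1_le_sqrt _ _ _ l2).
apply: ler_sum => j _; rewrite normrM Pfv ler_piMr //.
rewrite -lee_fin; apply: le_trans f1; apply: ereal_sup_ubound.
by exists (v j) => // i; have [->|->] := hv j i; rewrite ?lexx ?ler01.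
Qed.

Theorem corollary3 (R : realType) (n : nat) (hn : (1 <= n)%N)
    (hH : hadamard_number R n.+1)
    (v : 'I_n.+1 -> 'rV[R]_n)
    (hS : regular_simplex v)
    (hv : forall j, cube_vertices (v j))
    (P : ('rV[R]_n -> R) -> ('rV[R]_n -> R))
    (hP : interpolation_projector v P) :
  (operator_norm P <= (Num.sqrt (2 * n + 3)%:R + 1)%:E)%E.
Proof.
apply: le_trans (operator_norm_regular_cube_simplex _ _ _ _ hn hS hv hP) _.
rewrite lee_fin; apply: ler_wpDr => //.
by apply: ler_wsqrtr; rewrite ler_nat -addn1 leq_add // leq_pmull.
Qed.
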